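(* Let $d\geq1$ be an integer, $a>0$, $(\alpha,\beta,\gamma)\in\mathcal P_d$, and let $k$ be a positive integer. The function $r\mapsto g_d(r;a,\alpha,\beta,\gamma)$ from $[0,+\infty[$ to $\mathbb{R}$ is $k$ times differentiable at $r=a$ if, and only if, $\beta-\alpha+\gamma>k+\frac d2+1$.
   Context: $\mathcal P_d$ is the set of triplets $(\alpha,\beta,\gamma)$ of positive reals with $\alpha>\frac d2$, $2(\beta-\alpha)(\gamma-\alpha)\geq\alpha$ and $2(\beta+\gamma)\geq6\alpha+1$ (these imply $\beta>\alpha$, $\gamma>\alpha$). The radial part of the Gauss hypergeometric covariance is, for $r\geq0$, $$g_d(r;a,\alpha,\beta,\gamma)=\frac{\Gamma(\beta-\frac d2)\Gamma(\gamma-\frac d2)}{\Gamma(\beta-\alpha+\gamma-\frac d2)\Gamma(\alpha-\frac d2)}\left(1-\frac{r^2}{a^2}\right)_+^{\beta-\alpha+\gamma-\frac d2-1}{}_2F_1\left(\beta-\alpha,\gamma-\alpha;\beta-\alpha+\gamma-\tfrac d2;\left(1-\tfrac{r^2}{a^2}\right)_+\right),$$ where $(x)_+=\max\{x,0\}$ and ${}_2F_1$ is the Gauss hypergeometric function. *)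

(* Defs.v *)
From HB Require Import structures.
From mathcomp Require Import all_boot all_order all_algebra.
From mathcomp Require Import all_classical all_reals all_analysis.

Set Implicit Arguments.
Unset Strict Implicit.
Unset Printing Implicit Defensive.

Import Order.TTheory GRing.Theory Num.Theory.
Import numFieldNormedType.Exports.

Local Open Scope classical_set_scope.
Local Open Scope ring_scope.

(* Euler's integral: this is the Gamma function on the positive half-line
   only, not its continuation to negative non-integers. *)
Definition Gamma (R : realType) (x : R) : R :=
  \int[@lebesgue_measure R]_(t in `]0, +oo[) (t `^ (x - 1) * expR (- t)).

Definition pochhammer (R : realType) (x : R) (n : nat) : R :=
  \prod_(i < n) (x + i%:R).

(* The value is meaningful only where the Gauss series converges: for
   `|z| < 1, and for z = 1 when a + b < c. *)
Definition hypergeom2F1 (R : realType) (a b c z : R) : R :=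
  limn (pseries
    (fun n => pochhammer a n * pochhammer b n / (pochhammer c n * n`!%:R)) z).

Definition in_Pd (R : realType) (d : nat) (alpha beta gamma : R) : Prop :=
  [/\ [/\ 0 < alpha, 0 < beta & 0 < gamma],
      d%:R / 2 < alpha,
      alpha <= 2 * (beta - alpha) * (gamma - alpha) &
      6 * alpha + 1 <= 2 * (beta + gamma)].

(* For parameters in P_d, all Gamma arguments and the exponent of the power are
   positive, so that 0 `^ _ = 0 applies for r >= a; moreover, the value at
   r = 0 is that of a convergent Gauss series at 1.
   On r < 0 this is the even extension of the function on [0, +oo[. *)
Definition gauss_hypergeom_cov (R : realType) (d : nat)
    (a alpha beta gamma r : R) : R :=
  let z := Num.max (1 - r ^+ 2 / a ^+ 2) 0 in
  Gamma (beta - d%:R / 2) * Gamma (gamma - d%:R / 2) /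
    (Gamma (beta - alpha + gamma - d%:R / 2) * Gamma (alpha - d%:R / 2)) *
  z `^ (beta - alpha + gamma - d%:R / 2 - 1) *
  hypergeom2F1 (beta - alpha) (gamma - alpha)
    (beta - alpha + gamma - d%:R / 2) z.

(* f^`(j) is total, hence its derivability does not by itself entail that the
   lower order derivatives exist: the derivatives of order < n are required to
   exist on a neighbourhood of x, and the n-th one at x. *)
Definition times_differentiable_at (R : realType) (n : nat) (f : R -> R)
    (x : R) : Prop :=
  (forall j, (j.+1 < n)%N -> \forall y \near x, derivable f^`(j)%classic y 1) /\
  (forall j, (j < n)%N -> derivable f^`(j)%classic x 1).

(* Main.v *)
Require Import Defs.
From HB Require Import structures.
From mathcomp Require Import all_boot all_order all_algebra.
From mathcomp Require Import all_classical all_reals all_analysis.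
From mathcomp Require Import measurable_realfun ring lra.
Import Order.TTheory GRing.Theory Num.Theory.
Import numFieldNormedType.Exports.
Local Open Scope ring_scope.
Local Open Scope classical_set_scope.

(* Near a the covariance is K z_+^s F(z) with z = 1 - r^2/a^2,
   s = beta - alpha + gamma - d/2 - 1, K > 0, F analytic on |z| < 1 and
   F(0) = 1; membership in P_d forces s > 0, and the claim becomes: k times
   differentiable at a iff k < s.  If k < s, then z_+^s is k times
   differentiable, since (x_+^s)' = s x_+^(s-1) for s > 1.  Conversely, the
   function vanishes on [a, +oo[, so k-fold differentiability at a and the mean
   value theorem make it o((a - r)^k) on the left of a, whereas it is at least
   a positive multiple of (a - r)^s there. *)

(** * Repeated differentiability on a set and its calculus rules *)

Section iterated_derivatives.
Context {R : realType}.
Implicit Types (U V : set R) (f g : R -> R).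

(** The derivative is an existential witness, pinned down on [U] only, so that closure under sums,
    products and composition goes by induction without handling iterated total derivatives. *)
Fixpoint diffn_on (n : nat) U f : Prop :=
  if n is m.+1 then
    exists g, (forall x, U x -> is_derive x 1 f (g x)) /\ diffn_on m U g
  else True.

Lemma diffn_onW n U f : diffn_on n.+1 U f -> diffn_on n U f.
Proof.
elim: n f => [//|n IHn] f [g [fg ng]].
by exists g; split=> //; exact: IHn.
Qed.

Lemma eq_diffn_on n U f g : open U -> (forall x, U x -> f x = g x) ->
  diffn_on n U f -> diffn_on n U g.
Proof.
case: n => [//|n] oU fg [h [fh nh]]; exists h; split=> // x Ux.
apply: near_eq_is_derive (fh x Ux).
by near=> y; apply: fg; near: y; exact: open_nbhs_nbhs.
Unshelve. all: by end_near. Qed.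

Lemma diffn_on_cst n U (c : R) : diffn_on n U (fun=> c).
Proof.
elim: n c => [//|n IHn] c; exists (fun=> 0).
by split=> [x _|]; [exact: is_derive_cst|exact: IHn].
Qed.

Lemma diffn_on_id n U : diffn_on n U id.
Proof.
case: n => [//|n]; exists (fun=> 1); split=> [x _|]; first exact: is_derive_id.
exact: diffn_on_cst.
Qed.

Lemma diffn_onD n U f g : diffn_on n U f -> diffn_on n U g ->
  diffn_on n U (fun x => f x + g x).
Proof.
elim: n f g => [//|n IHn] f g [f' [ff' nf']] [g' [gg' ng']].
exists (fun x => f' x + g' x); split=> [x Ux|]; last exact: IHn.
exact: is_deriveD (ff' x Ux) (gg' x Ux).
Qed.

Lemma diffn_onM n U f g : diffn_on n U f -> diffn_on n U g ->
  diffn_on n U (fun x => f x * g x).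
Proof.
elim: n f g => [//|n IHn] f g nf ng.
(* The product rule brings back [f] and [g] themselves, to which the induction hypothesis is applied
   at order [n]. *)
have := diffn_onW _ _ _ nf; have := diffn_onW _ _ _ ng.
case: nf ng => [f' [ff' nf']] [g' [gg' ng']] ng nf.
exists (fun x => f x * g' x + g x * f' x); split=> [x Ux|].
  exact: is_deriveM (ff' x Ux) (gg' x Ux).
by apply: diffn_onD; exact: IHn.
Qed.

Lemma diffn_on_comp n U V f g : (forall x, V x -> U (g x)) ->
  diffn_on n U f -> diffn_on n V g -> diffn_on n V (f \o g).
Proof.
move=> VU; elim: n f => [//|n IHn] f [f' [ff' nf']] ng.
have ng1 := diffn_onW _ _ _ ng; case: ng => [g' [gg' ng']].
exists (fun x => f' (g x) * g' x); split=> [x Vx|].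
  exact: is_derive1_comp (ff' _ (VU _ Vx)) (gg' x Vx).
by apply: diffn_onM => //; exact: IHn.
Qed.

(** The total derivative agrees with the witness on [U] only; openness of [U] lets the higher
    derivatives be transferred. *)
Lemma diffn_on_derivable n U f : open U -> diffn_on n U f ->
  forall j, (j < n)%N -> forall x, U x -> derivable f^`(j) x 1.
Proof.
move=> oU; elim: n f => [//|n IHn] f [g [fg ng]] [_|j] x Ux.
  by rewrite derive1n0; have [] := fg _ Ux.
rewrite derive1Sn; apply: IHn => //; apply: eq_diffn_on ng => // y Uy.
by rewrite derive1E; have /@derive_val := fg _ Uy.
Qed.

Lemma diffn_on_times_differentiable_at n U f x : open U -> U x ->
  diffn_on n U f -> times_differentiable_at n f x.
Proof.
move=> oU Ux nf; split=> j jn.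
  near=> y; apply: (diffn_on_derivable _ _ _ oU nf); first exact: ltnW.
  by near: y; exact: open_nbhs_nbhs.
exact: (diffn_on_derivable _ _ _ oU nf).
Unshelve. all: by end_near. Qed.

End iterated_derivatives.

(** * Powers of the positive part *)

Section positive_part_power.
Context {R : realType}.
Implicit Types s x : R.

Lemma powR_max0_cvg0 s : 0 < s -> (Num.max x 0) `^ s @[x --> (0 : R)] --> (0 : R).
Proof.
move=> s0; apply/cvgrPdist_le => e e0.
near=> x; rewrite sub0r normrN ger0_norm ?powR_ge0//.
have -> : e = (e `^ s^-1) `^ s.
  by rewrite -powRrM mulVf ?gt_eqF// powRr1// ltW.
apply: ge0_ler_powR; rewrite ?nnegrE ?powR_ge0 ?(ltW s0)//.
  by rewrite le_max lexx orbT.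
rewrite ge_max powR_ge0 andbT; apply/ltW.
by near: x; apply: lt_nbhsl; rewrite powR_gt0.
Unshelve. all: by end_near. Qed.

Lemma is_derive_powR_max0 s x : 1 < s ->
  is_derive x 1 (fun x => (Num.max x 0) `^ s) (s * (Num.max x 0) `^ (s - 1)).
Proof.
move=> s1; have s0 : s != 0 by rewrite gt_eqF// (lt_trans _ s1).
have s10 : s - 1 != 0 by rewrite gt_eqF// subr_gt0.
have [x0|x0|<-] := ltgtP 0 x.
- apply: near_eq_is_derive (is_derive1_powR s x0).
  near=> y; rewrite (max_idPl _)//; apply/ltW; near: y; exact: lt_nbhsr.
- rewrite powR0// mulr0.
  apply: near_eq_is_derive (is_derive_cst 0 x 1).
  near=> y; rewrite (max_idPr _) ?powR0//; apply/ltW; near: y; exact: lt_nbhsl.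
- rewrite powR0// mulr0.
  suff H : h^-1 *: (Num.max (h *: (1 : R) + 0 : R) 0 `^ s - Num.max 0 0 `^ s) @[h --> (0:R)^'] --> (0 : R).
    by split; [apply/cvg_ex; exists 0|exact: cvg_lim H].
  (* At the origin the difference quotient of x_+^s is exactly h_+^(s-1), which tends to 0 since s >
     1. *)
  apply: (@cvg_trans _ ((Num.max x 0) `^ (s - 1) @[x --> (0:R)^'])); last first.
    by apply: cvg_within_filter; apply: powR_max0_cvg0; rewrite subr_gt0.
  apply: near_eq_cvg; near=> h.
  have h0 : h != 0 by near: h; exact: nbhs_dnbhs_neq.
  rewrite maxxx (powR0 s0) subr0 addr0 /GRing.scale/= mulr1.
  have [{}h0|{}h0|] := ltgtP 0 h; last by move=> /esym/eqP; rewrite (negbTE h0).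
    by rewrite powRB ?gt_eqF ?implybT// powRr1 ?ltW// mulrC.
  by rewrite !powR0 ?mulr0.
Unshelve. all: by end_near. Qed.

Lemma diffn_on_powR_max0 n U s : n%:R < s ->
  diffn_on n U (fun x => (Num.max x 0) `^ s).
Proof.
elim: n s => [//|n IHn] s ns.
exists (fun x => s * (Num.max x 0) `^ (s - 1)); split=> [x _|].
  by apply: is_derive_powR_max0; apply: le_lt_trans ns; rewrite ler1n.
apply: diffn_onM; first exact: diffn_on_cst.
by apply: IHn; rewrite ltrBrDr natr1.
Qed.

End positive_part_power.

(** * Power series with radius of convergence at least 1 *)

Section power_series.
Context {R : realType}.
Implicit Types c : R^nat.

(* Stable under termwise differentiation, and forces radius of convergence at
   least 1. *)
Definition subexponential c := forall L : R, 1 < L ->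
  \forall n \near \oo, `|c n.+1| <= L * `|c n|.

Lemma subexponential_bound c L : subexponential c -> 1 < L ->
  exists K, forall n, `|c n| <= K * L ^+ n.
Proof.
(* This constant dominates the coefficients up to index [N]; beyond it the ratio bound propagates
   the estimate. *)
move=> sc L1; have [N _ cN] := sc _ L1; exists (\sum_(i < N.+1) `|c i|).
have L0 : 0 <= L by apply/ltW/(lt_trans _ L1).
have K0 : 0 <= \sum_(i < N.+1) `|c i| by exact: sumr_ge0.
elim=> [|n IHn].
  by rewrite expr0 mulr1 big_ord_recl lerDl sumr_ge0.
have [nN|Nn] := ltnP n N.
  apply: le_trans (_ : _ <= (\sum_(i < N.+1) `|c i|) * 1) _.
    by rewrite mulr1 (bigD1 (Ordinal (nN : n.+1 < N.+1)%N))//= lerDl sumr_ge0.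
  by rewrite ler_wpM2l// exprn_ege1// ltW.
rewrite exprS mulrCA; apply: le_trans (cN _ Nn) _.
by rewrite ler_wpM2l.
Qed.

Lemma subexponential_cvg c x : subexponential c -> `|x| < 1 -> cvgn (pseries c x).
Proof.
move=> sc x1; have d0 : 0 < 1 + `|x| by rewrite ltr_pwDl.
(* Chosen so that L > 1 and L|x| < 1: a geometric series of ratio L|x| then dominates. *)
pose L := 2 / (1 + `|x|).
have L1 : 1 < L by rewrite /L ltr_pdivlMr// mul1r; lra.
have Lx : L * `|x| < 1 by rewrite /L mulrAC ltr_pdivrMr// mul1r; lra.
have Lx0 : 0 <= L * `|x| by rewrite mulr_ge0// ltW// (lt_trans _ L1).
have [K cK] := subexponential_bound _ _ sc L1.
have K0 : 0 <= K by have := cK 0; rewrite expr0 mulr1; exact: le_trans.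
apply: normed_cvg.
apply: (@series_le_cvg _ _ (geometric K (L * `|x|))).
- by move=> n /=.
- by move=> n; exact: geometric_ge0.
- by move=> n /=; rewrite normrM normrX exprMn mulrA ler_wpM2r.
- by apply: is_cvg_geometric_series; rewrite ger0_norm.
Qed.

Lemma subexponential_diffs c : subexponential c -> subexponential (pseries_diffs c).
Proof.
(* Half of the margin L - 1 is kept for the factor (n+2)/(n+1) due to differentiation; it suffices
   once n >= 2/(L-1). *)
move=> sc L L1; have L'1 : 1 < (1 + L) / 2 by lra.
have [N _ cN] := sc _ L'1; near=> n; rewrite /pseries_diffs !normrM !normr_nat.
apply: le_trans (_ : n.+2%:R * ((1 + L) / 2 * `|c n.+1|) <= _).
  rewrite ler_wpM2l//; apply: cN; rewrite /=; apply: leqW.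
  by near: n; exact: nbhs_infty_ge.
rewrite !mulrA ler_wpM2r// -natr1 -(natr1 n).
have : 2 / (L - 1) <= n%:R by near: n; exact: nbhs_infty_ger.
by rewrite ler_pdivrMr ?subr_gt0//; nra.
Unshelve. all: by end_near. Qed.

Lemma is_derive_pseries c (x : R) : subexponential c -> `|x| < 1 ->
  is_derive x (1 : R) (fun x => limn (pseries c x)) (limn (pseries (pseries_diffs c) x)).
Proof.
move=> sc x1; have K0 : 0 <= (1 + `|x|) / 2 by rewrite divr_ge0// addr_ge0.
have K1 : `|(1 + `|x|) / 2| < 1 by rewrite (ger0_norm K0); lra.
(* Termwise differentiation asks that the series and its first two derived series converge at a
   point beyond |x|, here midway to 1. *)
apply: (@pseries_snd_diffs _ _ ((1 + `|x|) / 2)).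
- exact: subexponential_cvg.
- by apply: subexponential_cvg => //; exact: subexponential_diffs.
- by apply: subexponential_cvg => //; do 2 apply: subexponential_diffs.
- by rewrite (ger0_norm K0); lra.
Qed.

Lemma diffn_on_pseries n c : subexponential c ->
  diffn_on n [set x | `|x| < 1] (fun x => limn (pseries c x)).
Proof.
elim: n c => [//|n IHn] c sc; exists (fun x => limn (pseries (pseries_diffs c) x)).
by split=> [x /= x1|]; [exact: is_derive_pseries|exact/IHn/subexponential_diffs].
Qed.

Lemma pseries0 c : limn (pseries c 0) = c 0.
Proof.
apply: lim_near_cst => //; near=> n; rewrite /pseries/=.
have n0 : (0 < n)%N by near: n; exact: nbhs_infty_gt.
rewrite /series/= -(prednK n0) big_nat_recl// expr0 mulr1 big1 ?addr0// => i _.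
by rewrite exprS mul0r mulr0.
Unshelve. all: by end_near. Qed.

End power_series.

(** * Positivity of Euler's integral *)

Section Gamma_positivity.
Context {R : realType}.
Implicit Types x t : R.
Local Notation mu := (@lebesgue_measure R).

Lemma exprn_le_expR_half n : exists2 c : R, 0 <= c &
  forall t, 0 < t -> t ^+ n.+1 <= c * expR (t / 2).
Proof.
exists (2 ^+ n.+1 * n.+1`!%:R) => [|t t0]; first by rewrite mulr_ge0.
have t20 : 0 <= t / 2 by rewrite divr_ge0// ltW.
have H : (t / 2) ^+ n.+1 / n.+1`!%:R <= expR (t / 2).
  by apply: le_trans (expR_ge1Dxn n t20); rewrite lerDr.
rewrite ler_pdivrMr ?ltr0n ?fact_gt0// expr_div_n ler_pdivrMr ?exprn_gt0// in H.
by rewrite mulrC (mulrC (2 ^+ _)) mulrA.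
Qed.

(** Equivalently exp(-t) <= K/(1 + t^x)^2, which bounds the Gamma integrand by a multiple of an
    exact derivative. It is the square of a bound of 1 + t^x by a multiple of exp(t/2). *)
Lemma sqr_add1_powR_le_expR x : 0 < x ->
  exists2 K, 0 <= K & forall t, 0 < t -> (1 + t `^ x) ^+ 2 <= K * expR t.
Proof.
move=> x0; have [n xn] : exists n : nat, x <= n.+1%:R.
  by exists (Num.truncn x); apply/ltW; rewrite truncnS_gt.
have [c c0 tn] := exprn_le_expR_half n.
exists ((2 + c) ^+ 2) => [|t t0]; first exact: sqr_ge0.
have e1 : 1 <= expR (t / 2) by rewrite -expR0 ler_expR divr_ge0// ltW.
have tx : t `^ x <= 1 + t ^+ n.+1.
  have [t1|/ltW t1] := leP t 1.
    apply: le_trans (_ : 1 <= _); last by rewrite lerDl exprn_ge0// ltW.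
    by rewrite -(powRr0 t) ger_powR ?t0// ltW.
  rewrite -powR_mulrn ?(ltW t0)//; apply: le_trans (ler_powR t1 xn) _.
  by rewrite lerDr.
have -> : expR t = expR (t / 2) ^+ 2 by rewrite expr2 -expRD -splitr.
rewrite -exprMn; apply: lerXn2r; rewrite ?nnegrE.
- by rewrite addr_ge0// powR_ge0.
- by rewrite mulr_ge0 ?expR_ge0// addr_ge0.
- rewrite mulrDl; apply: le_trans (lerD (lexx 1) tx) _.
  rewrite addrA; apply: lerD; last exact: tn.
  by rewrite -[leLHS]mulr1 ler_wpM2l.
Qed.

(* The integrand is the derivative of the bounded function - (1 + t `^ x)^-1
   and dominates t `^ (x - 1) * expR (- t) up to a constant. *)
Lemma integral_powR_sqr_add1_le x (a b : R) : 0 < x -> 0 < a -> a < b ->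
  (\int[mu]_(t in `[a, b]) (x * t `^ (x - 1) * ((1 + t `^ x)^-1 * (1 + t `^ x)^-1))%:E <= 1)%E.
Proof.
move=> x0 a0 ab.
have p t : 0 < 1 + t `^ x by rewrite ltr_pwDl// powR_ge0.
have d1 t : 0 < t -> is_derive t 1 (fun t => 1 + t `^ x) (x * t `^ (x - 1)).
  move=> t0; have := is_deriveD (is_derive_cst (1 : R) t 1) (is_derive1_powR x t0).
  by rewrite add0r.
have dV t : 0 < t -> is_derive t 1 (fun t => (1 + t `^ x)^-1)
    (- (x * t `^ (x - 1) * ((1 + t `^ x)^-1 * (1 + t `^ x)^-1))).
  move=> t0; have [/= D E] := d1 t t0; split; first by apply: derivableV; rewrite ?gt_eqF.
  by rewrite deriveV ?gt_eqF// E /GRing.scale/= mulNr mulrC expr2 invfM.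
rewrite (@continuous_FTC2 _ _ (fun t => - (1 + t `^ x)^-1))//.
- rewrite -EFinD lee_fin opprK.
  have : (1 + a `^ x)^-1 <= 1 by rewrite invf_le1// lerDl powR_ge0.
  have : 0 <= (1 + b `^ x)^-1 by rewrite invr_ge0 ltW.
  lra.
- apply: derivable_within_continuous => t /itvP tab.
  have t0 : 0 < t by apply: lt_le_trans a0 _; rewrite tab.
  apply: derivableM.
    by apply: derivableM => //; apply: derivable_powR; rewrite in_itv/= t0.
  by apply: derivableM; have [] := dV t t0.
- have cH t : 0 < t -> {for t, continuous (fun t : R => - (1 + t `^ x)^-1)}.
    move=> t0; apply/differentiable_continuous; rewrite -derivable1_diffP.
    by apply: derivableN; have [] := dV t t0.
  split.
  + move=> t /itvP tab; apply: derivableN.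
    by have [] := dV t _; rewrite // (lt_trans a0)// tab.
  + by apply: cvg_at_right_filter; exact: cH.
  + by apply: cvg_at_left_filter; apply: cH; exact: lt_trans ab.
- move=> t /itvP tab; have t0 : 0 < t by rewrite (lt_trans a0)// tab.
  have [D E] := dV t t0.
  by rewrite derive1E deriveN// E opprK.
Qed.

(** The real-valued integral would be 0 if the extended one were infinite, so finiteness has to be
    shown besides a positive lower bound. *)
Lemma Gamma_gt0 x : 0 < x -> 0 < Gamma x.
Proof.
move=> x0; rewrite /Gamma /Rintegral.
pose g t : R := t `^ (x - 1) * expR (- t).
have g0 t : 0 <= g t by rewrite mulr_ge0 ?powR_ge0 ?expR_ge0.
have mg (D : set R) : measurable_fun D (EFin \o g).
  apply/measurable_EFinP/measurable_funTS; apply: measurable_funM.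
    exact: measurable_powR.
  by apply: measurableT_comp => //; exact: measurableT_comp.
(* An increasing exhaustion by compact intervals avoiding 0; the shift by 2 keeps the endpoints
   distinct at n = 0. *)
pose F n : set R := `[n.+2%:R^-1, n.+2%:R]%classic.
have mF n : measurable (F n) by exact: measurable_itv.
have itvE : `]0, +oo[%classic = \bigcup_n F n.
  rewrite /F; apply/seteqP; split=> [t|t [n _]] /=; rewrite !in_itv/=.
    rewrite andbT => t0; exists (Num.truncn (t + t^-1)) => //=; rewrite in_itv/=.
    have := truncnS_gt (t + t^-1); set m := Num.truncn _ => tm.
    have tm2 : t + t^-1 <= m.+2%:R.
      by apply/ltW/(lt_le_trans tm); rewrite ler_nat.
    have tV0 : 0 < t^-1 by rewrite invr_gt0.
    apply/andP; split; last by apply: le_trans tm2; rewrite lerDl ltW.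
    rewrite -[leRHS]invrK lef_pV2 ?posrE ?invr_gt0//.
    by apply: le_trans tm2; rewrite lerDr ltW.
  by move=> /andP[+ _]; rewrite andbT; apply: lt_le_trans; rewrite invr_gt0.
have [K K0 gK] := sqr_add1_powR_le_expR _ x0.
have gle t : 0 < t ->
    g t <= K / x * (x * t `^ (x - 1) * ((1 + t `^ x)^-1 * (1 + t `^ x)^-1)).
  move=> t0; have p : 0 < 1 + t `^ x by rewrite ltr_pwDl// powR_ge0.
  have -> : K / x * (x * t `^ (x - 1) * ((1 + t `^ x)^-1 * (1 + t `^ x)^-1)) =
      t `^ (x - 1) * (K / (1 + t `^ x) ^+ 2).
    by field; rewrite !gt_eqF.
  rewrite /g ler_wpM2l ?powR_ge0// expRN ler_pdivlMr ?exprn_gt0//.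
  by rewrite mulrC ler_pdivrMr ?expR_gt0// gK.
have le_fin n : (\int[mu]_(t in F n) (g t)%:E <= (K / x)%:E)%E.
  have a0 : 0 < n.+2%:R^-1 :> R by rewrite invr_gt0.
  have ab : n.+2%:R^-1 < n.+2%:R :> R.
    by apply: (@lt_trans _ _ 1); rewrite ?invf_lt1 ?ltr1n.
  have p t : 0 < 1 + t `^ x by rewrite ltr_pwDl// powR_ge0.
  have h0 t : 0 <= x * t `^ (x - 1) * ((1 + t `^ x)^-1 * (1 + t `^ x)^-1).
    by rewrite !mulr_ge0 ?powR_ge0 ?invr_ge0// ltW.
  have mh : measurable_fun (F n)
      (fun t => (x * t `^ (x - 1) * ((1 + t `^ x)^-1 * (1 + t `^ x)^-1))%:E).
    apply/measurable_EFinP/measurable_funTS.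
    rewrite (_ : (fun _ => _) = (fun t => x * t `^ (x - 1) *
      ((1 + t `^ x) `^ (-1) * (1 + t `^ x) `^ (-1)))); last first.
      by apply/funext => t; rewrite powR_inv1// ltW.
    have m1 : measurable_fun setT (fun t : R => (1 + t `^ x) `^ (-1)).
      apply: (measurableT_comp (f := fun t : R => t `^ (-1))).
        exact: measurable_powR.
      by apply: measurable_funD => //; exact: measurable_powR.
    apply: measurable_funM; last exact: measurable_funM.
    by apply: measurable_funM => //; exact: measurable_powR.
  apply: (@le_trans _ _ (\int[mu]_(t in F n)
      ((K / x)%:E * (x * t `^ (x - 1) * ((1 + t `^ x)^-1 * (1 + t `^ x)^-1))%:E))%E).
    apply: ge0_le_integral => //=.
    - exact: mF.
    - by move=> t _; rewrite lee_fin.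
    - exact: mg.
    - exact: measurable_funeM.
    - move=> t; rewrite /F/= in_itv/= => /andP[at_ _]; rewrite -EFinM lee_fin gle//.
      exact: lt_le_trans at_.
  rewrite ge0_integralZl//=; [|exact: mF|by move=> t _; rewrite lee_fin|];
    last by rewrite lee_fin divr_ge0// ltW.
  rewrite -[leRHS]mule1 lee_wpmul2l ?lee_fin ?divr_ge0 ?(ltW x0)//.
  exact: integral_powR_sqr_add1_le.
(* Monotone convergence along [F]: the bound K/x does not depend on n. *)
have lty : (\int[mu]_(t in `]0%R, +oo[) (g t)%:E < +oo)%E.
  rewrite itvE; apply: (@le_lt_trans _ _ (K / x)%:E); last by rewrite ltry.
  have ndF : nondecreasing_seq F.
    move=> i j ij; rewrite subsetEset => t; rewrite /F/= !in_itv/= => /andP[it ti].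
    apply/andP; split; [apply: le_trans it|apply: (le_trans ti)].
      by rewrite lef_pV2 ?posrE// ler_nat.
    by rewrite ler_nat.
  have H := @ge0_nondecreasing_set_cvg_integral _ (measurableTypeR R) _ F (EFin \o g) mu ndF
    mF (fun n => mg (F n)) (fun n t _ => g0 t).
  rewrite -(cvg_lim _ H)//; apply: lime_le.
    by apply/cvg_ex; eexists; exact: H.
  by near=> n; exact: le_fin.
apply: fine_gt0; rewrite lty andbT.
(* On [1, 2], t^(x-1) = t^x / t >= 1/2 and exp(-t) >= exp(-2). *)
pose c : R := expR (- 2) / 2.
have c0 : 0 < c by rewrite divr_gt0// expR_gt0.
apply: (@lt_le_trans _ _ (\int[mu]_(t in `[1%R, 2%R]) c%:E)%E).
  by rewrite integral_cst//= lebesgue_measure_itv/= lte_fin ltr1n -EFinD mule_gt0.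
apply: (@le_trans _ _ (\int[mu]_(t in `[1%R, 2%R]) (g t)%:E)%E).
  apply: ge0_le_integral => //=.
  - by move=> t _; rewrite lee_fin ltW.
  - exact: mg.
  - move=> t; rewrite in_itv/= => /andP[t1 t2]; rewrite lee_fin.
    have t0 : 0 < t by apply: lt_le_trans t1.
    rewrite /c mulrC; apply: ler_pM; rewrite ?invr_ge0 ?expR_ge0//.
      rewrite powRB ?(gt_eqF t0) ?implybT// powRr1 ?(ltW t0)//.
      rewrite -[leLHS]mul1r; apply: ler_pM; rewrite ?invr_ge0//.
        by rewrite -(powRr0 t) ler_powR// ltW.
      by rewrite lef_pV2 ?posrE.
    by rewrite ler_expR lerN2.
apply: ge0_subset_integral => //=.
- exact: mg.
- by move=> t _; rewrite lee_fin.
- by move=> t /=; rewrite !in_itv/= andbT => /andP[t1 _]; apply: lt_le_trans t1.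
Unshelve. all: by end_near. Qed.
End Gamma_positivity.

(** * Order of contact with 0 at the edge of the support *)

Section vanishing_on_the_right.
Context {R : realType}.
Implicit Types (f : R -> R) (a : R).

(** The two-sided derivative is also the limit of the right-hand difference quotients, which are all
    0. *)
Lemma derive_right_vanishing f a : derivable f a 1 ->
  (forall x, a <= x -> f x = 0) -> 'D_1 f a = 0.
Proof.
move=> df f0; have /= H := df.
apply: (@cvg_unique _ _ ((fun h => h^-1 *: (f (h *: (1 : R) + a) - f a)) @ (0:R)^'+)).
- exact: norm_hausdorff.
- exact: cvg_dnbhs_at_right H.
- apply: (@cvg_trans _ ((fun=> 0 : R) @ (0:R)^'+)); last exact: cvg_cst.
  apply: near_eq_cvg; near=> h.
  have h0 : 0 < h by [].
  by rewrite !f0 ?subr0 ?scaler0// /GRing.scale/= mulr1 lerDr ltW.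
Unshelve. all: by end_near. Qed.

Lemma derive1_right_vanishing f a : derivable f a 1 ->
  (forall x, a <= x -> f x = 0) -> forall x, a <= x -> f^`() x = 0.
Proof.
move=> df f0 x; rewrite le_eqVlt derive1E => /predU1P[<-|ax].
  exact: derive_right_vanishing.
rewrite (near_eq_derive (g := fun=> 0)) ?derive_cst//.
by near=> y; apply: f0; apply/ltW; near: y; exact: lt_nbhsr.
Unshelve. all: by end_near. Qed.

(** Taylor's formula with Peano remainder, all derivatives at [a] being 0. By induction: the
    derivative of [f] satisfies the same hypotheses, and the mean value theorem turns its bound into
    one for [f], gaining a factor a - x. *)
Lemma times_differentiable_at_littleo k f a :
  times_differentiable_at k.+1 f a -> (forall x, a <= x -> f x = 0) ->
  forall e, 0 < e -> exists2 d, 0 < d &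
    forall x, a - d < x -> x < a -> `|f x| <= e * (a - x) ^+ k.+1.
Proof.
elim: k f => [|k IHk] f [nf df] f0 e e0.
  have {}df := df 0 isT; rewrite derive1n0 in df.
  have := derive_right_vanishing _ _ df f0 => Df.
  have H0 : h^-1 *: (f (h *: (1 : R) + a) - f a) @[h --> (0:R)^'] --> 'D_1 f a.
    exact: df.
  move: H0; rewrite Df => /cvgrPdist_le/(_ _ e0)[d /= d0 H]; exists d => // x dx xa.
  have xa0 : 0 < a - x by rewrite subr_gt0.
  have /= := H (x - a); rewrite !sub0r !normrN (f0 a)// subr0 /GRing.scale/= mulr1 subrK.
  rewrite normrM normfV (distrC x) (gtr0_norm xa0) subr_eq0 lt_eqF// expr1 => {}H.
  have {H} : (a - x)^-1 * `|f x| <= e by apply: H => //; lra.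
  by rewrite ler_pdivrMl// mulrC.
have df0 := df 0 isT; rewrite derive1n0 in df0.
have tf' : times_differentiable_at k.+1 f^`() a.
  by split=> j jk; rewrite -derive1Sn; [exact: nf|exact: df].
have [d d0 H] := IHk _ tf' (derive1_right_vanishing _ _ df0 f0) e e0.
(* The mean value theorem needs [f] differentiable on all of [x, a], which the neighbourhood clause
   provides. *)
have [d' /= d'0 H'] := nf 0 isT.
exists (Num.min d d'); first by rewrite lt_min d0.
move=> x; rewrite ltrBlDr -ltrBlDl lt_min => /andP[dx d'x] xa.
have dy y : x <= y -> y <= a -> derivable f y 1.
  move=> xy ya; apply: (H' y) => /=.
  by rewrite ger0_norm ?subr_ge0//; lra.
have [||c cxa E] := @MVT _ f (fun y => f^`() y) _ _ xa.
- move=> y /itvP yxa; apply: DeriveDef; last by rewrite derive1E.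
  by apply: dy; rewrite yxa.
- apply: derivable_within_continuous => y /itvP yxa.
  by apply: dy; rewrite yxa.
move: E; rewrite f0// sub0r => E.
rewrite -normrN E normrM (gtr0_norm (_ : 0 < a - x)) ?subr_gt0//.
rewrite exprSr mulrA ler_wpM2r ?subr_ge0 ?(ltW xa)//.
have [xc ca] : x < c /\ c < a by rewrite !(itvP cxa).
apply: le_trans (H c _ ca) _; first lra.
rewrite ler_wpM2l ?(ltW e0)// lerXn2r// ?nnegrE ?subr_ge0 ?ltW// ; lra.
Qed.

End vanishing_on_the_right.

(** * The Gauss series on ]-1, 1[ *)

Section gauss_hypergeometric.
Context {R : realType}.
Implicit Types a b c z : R.

Lemma pochhammer_gt0 a n : 0 < a -> 0 < pochhammer a n.
Proof. by move=> a0; apply: prodr_gt0 => i _; rewrite ltr_wpDr. Qed.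

Lemma pochhammerS a n : pochhammer a n.+1 = pochhammer a n * (a + n%:R).
Proof. exact: big_ord_recr. Qed.

Definition gauss_coeff a b c n : R :=
  pochhammer a n * pochhammer b n / (pochhammer c n * n`!%:R).

(** Consecutive coefficients have ratio (a+n)(b+n)/((c+n)(1+n)), which tends to 1. *)
Lemma gauss_coeff_subexponential a b c : 0 < a -> 0 < b -> 0 < c ->
  subexponential (gauss_coeff a b c).
Proof.
move=> a0 b0 c0 L L1.
have p0 n : 0 < gauss_coeff a b c n.
  by rewrite divr_gt0// mulr_gt0 ?pochhammer_gt0// ltr0n fact_gt0.
have pS n : gauss_coeff a b c n.+1 =
    (a + n%:R) * (b + n%:R) / ((c + n%:R) * (1 + n%:R)) * gauss_coeff a b c n.
  rewrite /gauss_coeff !pochhammerS factS natrM nat1r; field.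
  rewrite !gt_eqF ?pochhammer_gt0 ?ltr0n ?fact_gt0// ?ltr_wpDr//.
near=> n; rewrite !gtr0_norm// pS ler_wpM2r ?(ltW (p0 _))//.
have n0 : 0 <= n%:R :> R by [].
rewrite ler_pdivrMr ?mulr_gt0 ?ltr_wpDr//.
have n1 : 1 <= n%:R :> R by rewrite ler1n; near: n; exact: nbhs_infty_gt.
(* With n >= 1 this gives (a+n)(b+n) <= n^2 + (a+b+ab)n <= L n^2 <= L(c+n)(1+n). *)
have : (a + b + a * b) / (L - 1) <= n%:R by near: n; exact: nbhs_infty_ger.
rewrite ler_pdivrMr ?subr_gt0// => Hn.
have ab0 : 0 < a * b by rewrite mulr_gt0.
have H1 : (a + b + a * b) * n%:R <= n%:R * (L - 1) * n%:R by rewrite ler_wpM2r.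
have H2 : a * b <= a * b * n%:R by rewrite ler_peMr// ltW.
have H3 : 0 <= L * c * (1 + n%:R) by rewrite !mulr_ge0 ?addr_ge0// ltW// (lt_trans _ L1).
have H4 : 0 <= L * n%:R by rewrite mulr_ge0// ltW// (lt_trans _ L1).
move: H1 H2 H3 H4; move: (n%:R) => N; clear; nra.
Unshelve. all: by end_near. Qed.

Lemma hypergeom2F1_0 a b c : hypergeom2F1 a b c 0 = 1.
Proof.
rewrite /hypergeom2F1 pseries0 /pochhammer !big_ord0 fact0.
by rewrite !mulr1 divr1.
Qed.

Lemma diffn_on_hypergeom2F1 n a b c : 0 < a -> 0 < b -> 0 < c ->
  diffn_on n [set z | `|z| < 1] (hypergeom2F1 a b c).
Proof.
by move=> a0 b0 c0; apply: diffn_on_pseries; exact: gauss_coeff_subexponential.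
Qed.

End gauss_hypergeometric.

(** * Differentiability at [a] of K z_+^s F(z) for a general factor [F] *)

Section cutoff_powers.
Context {R : realType}.
Implicit Types a b c s K : R.

Lemma cutoff_times_differentiable_at a s K (F : R -> R) k : 0 < a -> k%:R < s ->
  (forall n, diffn_on n [set z | `|z| < 1] F) ->
  times_differentiable_at k
    (fun r => let z := Num.max (1 - r ^+ 2 / a ^+ 2) 0 in K * z `^ s * F z) a.
Proof.
move=> a0 ks dF.
have s0 : s != 0 by rewrite gt_eqF// (le_lt_trans _ ks).
pose z r := 1 - r ^+ 2 / a ^+ 2.
(* Here 0 < r/a < 5/4, hence -9/16 < z < 1 and [F] is smooth at z. *)
pose U : set R := `]0, 5 / 4 * a[%classic.
have oU : open U by exact: interval_open.
have Ua : U a by rewrite /U/= in_itv/= a0; lra.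
apply: (diffn_on_times_differentiable_at _ _ _ _ oU Ua).
(* [F] is now evaluated at z instead of z_+, which has a corner; for z < 0 both products vanish, as
   0^s = 0 for nonzero s. *)
apply: (@eq_diffn_on _ _ _ (fun r => K * (Num.max (z r) 0) `^ s * F (z r))) => //.
  move=> r _ /=; rewrite -/(z r); have [//|z0] := leP 0 (z r).
  by rewrite powR0// mulr0 !mul0r.
have dz n : diffn_on n U z.
  rewrite (_ : z = fun r => 1 + - (a ^+ 2)^-1 * (r * r)); last first.
    by apply/funext => r; rewrite /z expr2 mulNr mulrC.
  apply: diffn_onD; first exact: diffn_on_cst.
  apply: diffn_onM; first exact: diffn_on_cst.
  by apply: diffn_onM; exact: diffn_on_id.
apply: diffn_onM.
  apply: diffn_onM; first exact: diffn_on_cst.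
  exact: (diffn_on_comp _ setT _ (fun x => Num.max x 0 `^ s) _ _
    (diffn_on_powR_max0 _ _ _ ks) (dz k)).
apply: (diffn_on_comp _ _ _ F _ _ (dF k) (dz k)).
move=> r; rewrite /U/= in_itv/= => /andP[r0 ra].
rewrite /z -expr_div_n; set y := r / a.
have y0 : 0 < y by rewrite divr_gt0.
have y1 : y < 5 / 4 by rewrite ltr_pdivrMr.
by rewrite ltr_norml; apply/andP; split; nra.
Qed.

Lemma cutoff_not_times_differentiable_at a s K (F : R -> R) k : 0 < a ->
  0 < s -> s <= k.+1%:R -> 0 < K -> F 0 = 1 -> {for 0, continuous F} ->
  ~ times_differentiable_at k.+1
    (fun r => let z := Num.max (1 - r ^+ 2 / a ^+ 2) 0 in K * z `^ s * F z) a.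
Proof.
move=> a0 s0 sk K0 F0 cF; set f := (X in times_differentiable_at _ X) => tf.
have f0 x : a <= x -> f x = 0.
  move=> ax; rewrite /f (max_idPr _) ?powR0 ?gt_eqF ?mulr0 ?mul0r//.
  rewrite subr_le0 ler_pdivlMr ?exprn_gt0// mul1r lerXn2r ?nnegrE ?(ltW a0)//.
  by rewrite (le_trans (ltW a0)).
(* At the test point below a - r = a y, so the upper bound becomes (K/4) y^(k+1), half of the lower
   bound (K/2) y^(k+1) obtained from F > 1/2. *)
pose e := K / 4 / a ^+ k.+1.
have e0 : 0 < e by rewrite !divr_gt0// exprn_gt0.
have [d d0 Hd] := times_differentiable_at_littleo _ _ _ tf f0 e e0.
have [d' /= d'0 Hd'] : \forall z \near (0 : R), 2^-1 < F z.
  by apply: (cvgr_gt _ cF); rewrite F0; lra.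
(* The test point is r = a (1 - y), at which z = 2 y - y^2 lies in [y, 2 y]. *)
pose y := Num.min 2^-1 (Num.min (d / a) (d' / 2)) / 2.
have m0 : 0 < Num.min 2^-1 (Num.min (d / a) (d' / 2)).
  by rewrite !lt_min invr_gt0 ltr0n/= !divr_gt0.
have y0 : 0 < y by rewrite divr_gt0.
have ym : y < Num.min 2^-1 (Num.min (d / a) (d' / 2)).
  by rewrite /y; move: m0; set m := Num.min _ _ => m0; lra.
(* In turn: y < 1/2 gives z < 1, a y < d brings the test point within reach of [Hd], and 2 y < d'
   puts z where F > 1/2. *)
move: ym; rewrite !lt_min => /and3P[y12 yd yd'].
have {}yd : a * y < d by rewrite mulrC -ltr_pdivlMr.
have zE : 1 - (a * (1 - y)) ^+ 2 / a ^+ 2 = 2 * y - y ^+ 2.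
  by field; rewrite gt_eqF.
pose z := 2 * y - y ^+ 2.
have yz : y <= z by rewrite /z; nra.
have z2 : z <= 2 * y by rewrite /z; nra.
have z0 : 0 < z by exact: lt_le_trans yz.
have Fz : 2^-1 < F z.
  by apply: Hd'; rewrite /= sub0r normrN gtr0_norm//; lra.
(* As z < 1, raising the exponent from s to k+1 can only lower the power. *)
have zs : y ^+ k.+1 <= z `^ s.
  apply: (@le_trans _ _ (z ^+ k.+1)).
    by rewrite lerXn2r// nnegrE ltW.
  by rewrite -powR_mulrn ?(ltW z0)// ger_powR// z0; lra.
have yk : 0 < y ^+ k.+1 by rewrite exprn_gt0.
have := Hd (a * (1 - y)).
rewrite /f/= zE -/z (max_idPl (ltW z0)).
rewrite (_ : a - a * (1 - y) = a * y); last by ring.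
rewrite exprMn /e mulrA mulfVK ?gt_eqF ?exprn_gt0// => H.
have {}H : `|K * z `^ s * F z| <= K / 4 * y ^+ k.+1.
  by apply: H; nra.
have : K * y ^+ k.+1 * 2^-1 <= K * z `^ s * F z.
  apply: ler_pM; rewrite ?mulr_ge0 ?invr_ge0 ?(ltW K0) ?(ltW yk) ?(ltW Fz)//.
  by rewrite ler_wpM2l ?(ltW K0).
move=> /le_trans/(_ (ler_norm _))/le_trans/(_ H).
have : 0 < K * y ^+ k.+1 by rewrite mulr_gt0.
rewrite (mulrAC K 4^-1); move: (K * y ^+ k.+1) => M; clear; lra.
Qed.

End cutoff_powers.

(** * Reduction to the cutoff power through the inequalities of P_d *)

Theorem theorem6 (R : realType) (d : nat) (hd : (1 <= d)%N) (a : R) (ha : 0 < a)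
    (alpha beta gamma : R) (hP : in_Pd d alpha beta gamma)
    (k : nat) (hk : (0 < k)%N) :
  times_differentiable_at k (gauss_hypergeom_cov d a alpha beta gamma) a <->
  k%:R + d%:R / 2 + 1 < beta - alpha + gamma.
Proof.
case: hP => -[al0 be0 ga0] dal Hprod Hsum.
have d1 : 1 <= d%:R :> R by rewrite ler1n.
move: d1 dal; move Ed : (d%:R / 2) => D d1 dal.
have {d1} D12 : 1 / 2 <= D by rewrite -Ed; lra.
(* The product constraint gives both differences the same sign; both negative would contradict the
   sum constraint. *)
have [ba ga] : alpha < beta /\ alpha < gamma.
  by split; rewrite ltNge; apply/negP => ?; nra.
have A0 : 0 < beta - alpha by lra.
have B0 : 0 < gamma - alpha by lra.
have C0 : 0 < beta - alpha + gamma - D by lra.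
pose s := beta - alpha + gamma - D - 1.
(* The sum constraint and alpha > D give s >= 2 alpha - D - 1/2 > D - 1/2 >= 0, the last step by d
   >= 1. *)
have s0 : 0 < s by rewrite /s; lra.
have -> : (k%:R + D + 1 < beta - alpha + gamma) = (k%:R < s).
  by rewrite /s; apply/idP/idP => ?; lra.
rewrite /gauss_hypergeom_cov Ed -/s.
set K := Gamma _ * Gamma _ / _.
have K0 : 0 < K.
  by rewrite /K divr_gt0// mulr_gt0// Gamma_gt0//; lra.
pose F := hypergeom2F1 (beta - alpha) (gamma - alpha) (beta - alpha + gamma - D).
have dF n : diffn_on n [set z | `|z| < 1] F by exact: diffn_on_hypergeom2F1.
split=> [tf|ks]; last exact: (cutoff_times_differentiable_at _ _ K F).
rewrite ltNge; apply/negP => sk; case: k hk sk tf => // k _ sk.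
apply: (cutoff_not_times_differentiable_at _ _ K F) => //.
  exact: hypergeom2F1_0.
have [g [Fg _]] := dF 1%N.
apply/differentiable_continuous; rewrite -derivable1_diffP.
by have [] := Fg 0 _; rewrite //= normr0.
Qed.
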